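(* Let $p\in\sum\mathbb C\langle\underline z\rangle_d^2$ and let $\varepsilon>0$. Then the $\varepsilon$-ball $\{q\in\mathbb C\langle\underline z\rangle\mid\Vert p-q\Vert_2\leqslant\varepsilon\}$ around $p$ with respect to $\Vert\cdot\Vert_2$ contains a sum of at most $$\frac{\left(\sum_{\vert\nu\vert=d}p_{\nu^*\nu}\right)^2}{\varepsilon^2}$$ many Hermitian squares $w^*w$ of elements $w\in\mathbb C\langle\underline z\rangle_d$.
   Context: $\mathbb C\langle\underline z\rangle$ is the free $*$-algebra of non-commutative polynomials over $\mathbb C$ in the Hermitian variables $z_1,\ldots,z_n$: the involution is the conjugate-linear anti-automorphism with $z_i^*=z_i$, i.e. it reverses words and conjugates coefficients. $\mathbb C\langle\underline z\rangle_d$ is the subspace of homogeneous polynomials of degree $d$, with basis the words of length $d$. $\sum\mathbb C\langle\underline z\rangle_d^2$ is the set of all finite sums $\sum_k w_k^*w_k$ with $w_k\in\mathbb C\langle\underline z\rangle_d$; the empty sum (zero squares) equals $0$. For $p=\sum_\omega p_\omega\omega$, where $\omega$ ranges over words and $p_\omega\in\mathbb C$, the coefficient $2$-norm is $\Vert p\Vert_2=\left(\sum_\omega\vert p_\omega\vert^2\right)^{1/2}$. The sum $\sum_{\vert\nu\vert=d}p_{\nu^*\nu}$ runs over all words $\nu$ of length $d$ in $z_1,\ldots,z_n$, and $p_{\nu^*\nu}$ is the coefficient in $p$ of the word $\nu^*\nu$ (the reversal of $\nu$ followed by $\nu$). *)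

(* Defs.v *)
From mathcomp Require Import all_boot all_order all_algebra finmap.
From mathcomp Require Import reals.
From mathcomp Require Export complex monalg.

Set Implicit Arguments.
Unset Strict Implicit.
Unset Printing Implicit Defensive.

Import Order.TTheory GRing.Theory Num.Theory.

Local Open Scope ring_scope.

(* The complex numbers are [R[i]] with [R : realType].  The coercion from     *)
(* [{fmonom 'I_n}] to [seq 'I_n] lists the letters of a word, [p@_w] is the   *)
(* coefficient of the word [w] in [p], and [msupp p] is the finite set of     *)
(* words occurring in [p].                                                    *)
Notation ncpoly R n := {malg (complex R)[{fmonom 'I_n}]}.

Definition ncvar (R : realType) (n : nat) (i : 'I_n) : ncpoly R n :=
  << fmu i >>.

Definition wrev (n : nat) (w : {fmonom 'I_n}) : {fmonom 'I_n} :=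
  FMonom (rev w).

Definition ncstar (R : realType) (n : nat) (p : ncpoly R n) : ncpoly R n :=
  \sum_(w <- msupp p) << conjc p@_w *g wrev w >>.

Definition homogeneous (R : realType) (n d : nat) (p : ncpoly R n) : Prop :=
  forall w, w \in msupp p -> fdeg w = d.

Definition hsquares_sum (R : realType) (n : nat) (ws : seq (ncpoly R n)) :
    ncpoly R n :=
  \sum_(w <- ws) ncstar w * w.

Definition is_hsos (R : realType) (n d : nat) (p : ncpoly R n) : Prop :=
  exists2 ws : seq (ncpoly R n),
    (forall w, w \in ws -> homogeneous d w) & p = hsquares_sum ws.

Definition norm2 (R : realType) (n : nat) (p : ncpoly R n) : R :=
  Num.sqrt (\sum_(w <- msupp p) Normc.normc p@_w ^+ 2).

(* Complex-valued, like the coefficients of an arbitrary [p]; for a sum of    *)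
(* Hermitian squares it is a nonnegative real.  In [R[i]], [x <= y] means     *)
(* [Im y = Im x] and [Re x <= Re y], so a bound [N%:R <= y] includes the      *)
(* claim that [y] is real.                                                    *)
Definition squares_coef_sum (R : realType) (n d : nat) (p : ncpoly R n) :
    R[i] :=
  \sum_(nu : d.-tuple 'I_n) p@_(mmul (wrev (FMonom nu)) (FMonom nu)).

(* [ncstar] is the conjugate-linear anti-automorphism fixing the variables. *)
Section NcStar.
Variables (R : realType) (n : nat).
Implicit Types p q : ncpoly R n.

Lemma wrevK : involutive (@wrev n).
Proof. by case=> s; rewrite /wrev /= revK. Qed.

Lemma wrevM (u v : {fmonom 'I_n}) : wrev (mmul u v) = mmul (wrev v) (wrev u).
Proof. by apply/val_inj; rewrite /= fmM /= fmM rev_cat. Qed.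

Lemma ncstarE p w : (ncstar p)@_w = conjc p@_(wrev w).
Proof.
rewrite /ncstar raddf_sum /=.
have [wp|wp] := boolP (wrev w \in msupp p).
  rewrite (big_fsetD1 (wrev w)) //= wrevK mcoeffUU big1_fset ?addr0 // => u.
  rewrite in_fsetD1 => /andP[ne _] _.
  by rewrite mcoeffU (can2_eq wrevK wrevK) (negbTE ne).
rewrite (mcoeff_outdom wp) conjc0 big1_fset // => u up _.
rewrite mcoeffU (can2_eq wrevK wrevK).
by case: eqP => // eu; rewrite -eu up in wp.
Qed.

Lemma ncstar_var (i : 'I_n) : ncstar (ncvar R i) = ncvar R i.
Proof.
apply/malgP => w; rewrite ncstarE !mcoeffU -(can2_eq wrevK wrevK).
suff -> : wrev (fmu i) = fmu i by case: eqP; rewrite ?conjc1 ?conjc0.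
by apply/val_inj; rewrite /= fmU.
Qed.

Lemma ncstarK : involutive (@ncstar R n).
Proof. by move=> p; apply/malgP => w; rewrite !ncstarE wrevK conjcK. Qed.

Lemma ncstarD p q : ncstar (p + q) = ncstar p + ncstar q.
Proof. by apply/malgP => w; rewrite mcoeffD !ncstarE mcoeffD rmorphD. Qed.

Lemma ncstarZ (c : R[i]) p : ncstar (c *: p) = conjc c *: ncstar p.
Proof. by apply/malgP => w; rewrite mcoeffZ !ncstarE mcoeffZ rmorphM. Qed.

Lemma ncstar0 : ncstar (0 : ncpoly R n) = 0.
Proof. by rewrite -[0](scale0r 0) ncstarZ conjc0 !scale0r. Qed.

Lemma ncstar_sum (I : Type) (r : seq I) (F : I -> ncpoly R n) :
  ncstar (\sum_(i <- r) F i) = \sum_(i <- r) ncstar (F i).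
Proof. exact: (big_morph _ ncstarD ncstar0). Qed.

Lemma ncstarU (c : R[i]) (w : {fmonom 'I_n}) :
  ncstar << c *g w >> = << conjc c *g wrev w >>.
Proof.
apply/malgP => v; rewrite ncstarE !mcoeffU -(can2_eq wrevK wrevK).
by case: eqP; rewrite ?conjc0.
Qed.

Lemma ncstarM p q : ncstar (p * q) = ncstar q * ncstar p.
Proof.
rewrite [p]monalgE [q]monalgE mulr_suml !ncstar_sum mulr_sumr.
apply: eq_bigr => u _; rewrite mulr_sumr mulr_suml ncstar_sum.
apply: eq_bigr => v _.
by rewrite !malgM_def !fgmulUU !ncstarU fgmulUU wrevM rmorphM mulrC.
Qed.

End NcStar.

(* Main.v *)
(* Indexing by words of length d, p = sum_(i, j) G_ij (w_i)^* w_j for a       *)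
(* positive semidefinite Gram matrix G.  The words (w_i)^* w_j are pairwise   *)
(* distinct, so the coefficient norm of p is the Frobenius norm of G, while   *)
(* the sum of the coefficients p_(nu^* nu) is its trace T.  Diagonalize G in  *)
(* an orthonormal basis and drop the eigenvalues below eps^2 / T: at most     *)
(* T^2 / eps^2 remain, and the squares of the dropped ones sum to at most     *)
(* (eps^2 / T) * T = eps^2.                                                   *)
Require Import Defs.
From mathcomp Require Import all_boot all_order all_algebra.
From mathcomp Require Import reals finmap.
Import Order.TTheory GRing.Theory Num.Theory.
Local Open Scope ring_scope.
Local Open Scope complex_scope.

Set Implicit Arguments.
Unset Strict Implicit.
Unset Printing Implicit Defensive.

(** The theorem is a statement about positive semidefinite matrices. By [is_hsos_gram], [p] has a
    Gram matrix [W^t* *m W], the rows of [W] being the coefficient vectors of the squared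
    polynomials; conversely, by [hsquares_sum_rowpoly], a matrix [V] with [r] rows yields a sum of
    [r] squares. By [sqword_inj], coefficients of the polynomial are entries of its Gram matrix. So
    it suffices to approximate a Gram matrix of trace [T] in Frobenius norm by one of low rank,
    which is [gram_low_rank]. *)

Section LowRank.
Variable C : numClosedFieldType.
Local Open Scope sesquilinear_scope.

Lemma mxtrace_adjmul m n (A : 'M[C]_(m, n)) :
  \tr (A^t* *m A) = \sum_j \sum_i `|A i j| ^+ 2.
Proof.
rewrite /mxtrace; apply: eq_bigr => j _; rewrite mxE; apply: eq_bigr => i _.
by rewrite !mxE normCK mulrC.
Qed.

(** The Gram matrix is Hermitian, hence normal, hence unitarily diagonalizable. Its eigenvalues are
    nonnegative because they are the diagonal entries of the Gram matrix of [W *m P^t*], that is,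
    sums of squared moduli. *)
Lemma gram_spectral m n (W : 'M[C]_(m, n)) :
  exists2 P : 'M[C]_n, P \is unitarymx &
  exists2 D : 'rV[C]_n, (forall i, 0 <= D 0 i) &
    W^t* *m W = P^t* *m diag_mx D *m P.
Proof.
pose G := W^t* *m W.
have /orthomx_spectralP : G \is normalmx.
  by apply/normalmxP; rewrite /G trmx_mul map_mxM trmxCK.
have uP := spectral_unitarymx G.
move: (spectralmx G) (spectral_diag G) uP => P D uP GE.
exists P => //; exists D; last by rewrite -invmx_unitary.
move=> i; rewrite invmx_unitary // in GE.
have DE : diag_mx D = (W *m P^t* )^t* *m (W *m P^t* ).
  rewrite trmx_mul map_mxM trmxCK mulmxA -(mulmxA P) -/G GE !mulmxA.
  by rewrite !mulmxtVK // (unitarymxP _) // mul1mx.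
have := congr1 (fun M : 'M_n => M i i) DE; rewrite !mxE eqxx mulr1n => ->.
by apply: sumr_ge0 => k _; rewrite !mxE mulrC mul_conjC_ge0.
Qed.

Lemma mxtrace_unitary_conj n (P A : 'M[C]_n) :
  P \is unitarymx -> \tr (P^t* *m A *m P) = \tr A.
Proof. by move=> uP; rewrite mxtrace_mulC mulmxA (unitarymxP _) // mul1mx. Qed.

(** Unitary invariance of the Frobenius norm: written as the trace of [M^t* *m M], it loses [P] by
    cyclicity. *)
Lemma frobenius_unitary_diag n (P : 'M[C]_n) (E : 'rV[C]_n) :
  P \is unitarymx ->
  \sum_j \sum_i `|(P^t* *m diag_mx E *m P) i j| ^+ 2 = \sum_i `|E 0 i| ^+ 2.
Proof.
move=> uP; rewrite -mxtrace_adjmul !trmx_mul !map_mxM trmxCK tr_diag_mx.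
rewrite map_diag_mx !mulmxA mulmxtVK // -(mulmxA (P^t* )).
rewrite mxtrace_unitary_conj // mulmx_diag mxtrace_diag.
by apply: eq_bigr => i _; rewrite !mxE normCK mulrC.
Qed.

(** Cut the spectrum at the threshold [c]. Each kept eigenvalue contributes at least [c] to the
    trace, which bounds their number; each dropped eigenvalue [x] satisfies [x ^+ 2 <= c * x], which
    bounds the error. *)
Lemma gram_truncate m n (W : 'M[C]_(m, n)) (c : C) : 0 < c ->
  exists r, exists V : 'M[C]_(r, n),
    r%:R * c <= \tr (W^t* *m W) /\
    \sum_j \sum_i `|(W^t* *m W - V^t* *m V) i j| ^+ 2 <=
      c * \tr (W^t* *m W).
Proof.
move=> c0; have [P uP [D D0 GE]] := gram_spectral W.
pose K := [set i | c <= D 0 i].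
pose D' : 'rV[C]_n := \row_i (if i \in K then 0 else D 0 i).
exists #|K|.
(* One row per kept eigenvalue: the corresponding row of [P], scaled by the square root of the
   eigenvalue. *)
exists (\matrix_(k, j) (sqrtC (D 0 (enum_val k)) * P (enum_val k) j)).
set V := \matrix_(k, j) _.
have VE : V^t* *m V = P^t* *m diag_mx (D - D') *m P.
  apply/matrixP => i j; rewrite mul_mx_diag !mxE.
  under eq_bigr do rewrite !mxE.
  under [RHS]eq_bigr do rewrite !mxE.
  rewrite [RHS](bigID (fun k => k \in K)) /=.
  rewrite [X in _ = _ + X]big1 ?addr0; last first.
    by move=> k /negbTE ->; rewrite subrr mulr0 mul0r.
  rewrite [RHS]big_enum_val.
  apply: eq_bigr => k _; rewrite enum_valP subr0 rmorphM /=.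
  have /CrealP -> : sqrtC (D 0 (enum_val k)) \is Num.real.
    by rewrite ger0_real ?sqrtC_ge0.
  rewrite mulrACA -expr2 sqrtCK mulrA; congr (_ * _); exact: mulrC.
have TE : \tr (W^t* *m W) = \sum_i D 0 i.
  by rewrite GE mxtrace_unitary_conj // mxtrace_diag.
rewrite TE; split.
  rewrite (bigID (fun k => k \in K)) /= mulr_natl -sumr_const.
  rewrite -[leLHS]addr0 lerD ?sumr_ge0 //.
  by apply: ler_sum => i; rewrite inE.
have -> : W^t* *m W - V^t* *m V = P^t* *m diag_mx D' *m P.
  by rewrite VE GE -mulmxBl -mulmxBr -raddfB /= opprB addrC subrK.
rewrite frobenius_unitary_diag // mulr_sumr; apply: ler_sum => i _.
rewrite !mxE; case: ifP => [_|]; first by rewrite normr0 expr0n mulr_ge0 // ltW.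
rewrite inE => /negbT; rewrite -real_ltNge ?ger0_real ?(ltW c0) // => Dc.
by rewrite ger0_norm // expr2 ler_wpM2r // ltW.
Qed.

Lemma gram_low_rank m n (W : 'M[C]_(m, n)) (e : C) : 0 < e ->
  exists r, exists V : 'M[C]_(r, n),
    r%:R * e ^+ 2 <= \tr (W^t* *m W) ^+ 2 /\
    \sum_j \sum_i `|(W^t* *m W - V^t* *m V) i j| ^+ 2 <= e ^+ 2.
Proof.
move=> e0; set T := \tr _.
have T0 : 0 <= T.
  rewrite /T mxtrace_adjmul; apply: sumr_ge0 => j _.
  by apply: sumr_ge0 => i _; rewrite exprn_ge0.
(* The threshold is [e ^+ 2 / T], which makes the error bound exactly [e ^+ 2]. For [T = 0] it is
   not positive; the threshold 1 then gives rank and error 0. *)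
have [Tz|Tn] := eqVneq T 0.
  have [r [V []]] := gram_truncate W (@ltr01 C).
  rewrite -/T Tz !mulr1 => r0 V0; exists r, V; split.
    by rewrite expr0n mulr_le0_ge0 // exprn_ge0 // ltW.
  by apply: le_trans V0 _; rewrite mulr0 exprn_ge0 // ltW.
have Tp : 0 < T by rewrite lt_def Tn.
have [r [V []]] := gram_truncate W (divr_gt0 (exprn_gt0 2 e0) Tp).
rewrite -/T mulrA ler_pdivrMr // -expr2 divfK // => ? ?.
by exists r, V.
Qed.

End LowRank.


(** The image of [f] may exceed the support of [q]: the extra words have coefficient 0, so both sums
    have the same nonzero terms. *)
Lemma norm2_reindex (R : realType) (n : nat) (I : finType)
    (f : I -> {fmonom 'I_n}) (q : ncpoly R n) :
  injective f -> {subset msupp q <= codom f} ->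
  norm2 q = Num.sqrt (\sum_i Normc.normc q@_(f i) ^+ 2).
Proof.
move=> finj fsub; congr Num.sqrt.
rewrite -(big_image _ _ f predT
  (fun w : {fmonom 'I_n} => Normc.normc q@_w ^+ 2)).
apply: perm_big_supp; apply: uniq_perm; rewrite ?filter_uniq ?fset_uniq //.
  by rewrite -/(codom f) map_inj_uniq // enum_uniq.
move=> w; rewrite !mem_filter; case: eqP => //= w0.
apply/idP/idP => [/fsub //|_].
rewrite -mcoeff_neq0; apply: contra_notN w0 => /eqP ->.
by rewrite Normc.normc0 expr0n.
Qed.

Section Words.
Variables (R : realType) (n d : nat).
Local Notation T := (d.-tuple 'I_n).
Local Notation m := #|{: T}|.
Local Notation C := R[i].

(** Matrices are indexed by ordinals, so the words of length [d] are enumerated. *)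
Definition word (i : 'I_m) : {fmonom 'I_n} := FMonom (enum_val i : T).

Definition sqword (i j : 'I_m) : {fmonom 'I_n} := mmul (wrev (word i)) (word j).

Lemma word_inj : injective word.
Proof. by move=> i j [] /val_inj /enum_val_inj. Qed.

(** Both factors have length [d], so the product can be cut uniquely after [d] letters. *)
Lemma sqword_inj (i j k l : 'I_m) :
  (sqword i j == sqword k l) = (i == k) && (j == l).
Proof.
apply/eqP/andP => [|[/eqP -> /eqP ->] //].
move=> /(congr1 (fun w : {fmonom 'I_n} => w : seq 'I_n)).
rewrite /sqword !fmM /= => /eqP; rewrite eqseq_cat ?size_rev ?size_tuple //.
rewrite (can_eq revK) => /andP[/eqP/val_inj/enum_val_inj -> /eqP].
by move=> /val_inj/enum_val_inj ->.
Qed.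

Definition rowpoly (v : 'rV[C]_m) : ncpoly R n :=
  \sum_j << v 0 j *g word j >>.

Definition grampoly (A : 'M[C]_m) : ncpoly R n :=
  \sum_i \sum_j << A i j *g sqword i j >>.

Lemma mcoeff_rowpoly v j : (rowpoly v)@_(word j) = v 0 j.
Proof.
rewrite raddf_sum (bigD1 j) //= mcoeffUU big1 ?addr0 // => k kj.
by rewrite mcoeffU (inj_eq word_inj) (negbTE kj).
Qed.

Lemma mcoeff_grampoly A i j : (grampoly A)@_(sqword i j) = A i j.
Proof.
rewrite raddf_sum (bigD1 i) //= raddf_sum (bigD1 j) //= mcoeffUU.
rewrite !big1 ?addr0 // => [k ki|k kj].
  rewrite raddf_sum big1 // => l _.
  by rewrite /= mcoeffU sqword_inj (negbTE ki).
by rewrite mcoeffU sqword_inj (negbTE kj) andbF.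
Qed.

Lemma grampolyB A B : grampoly (A - B) = grampoly A - grampoly B.
Proof.
rewrite -sumrB; apply: eq_bigr => i _; rewrite -sumrB; apply: eq_bigr => j _.
by rewrite !mxE monalgUB.
Qed.

Lemma grampoly_sum r (A : 'I_r -> 'M[C]_m) :
  grampoly (\sum_k A k) = \sum_k grampoly (A k).
Proof.
rewrite exchange_big; apply: eq_bigr => i _.
rewrite exchange_big; apply: eq_bigr => j _.
by rewrite summxE raddf_sum.
Qed.

Lemma rowpoly_homogeneous v : homogeneous d (rowpoly v).
Proof.
move=> w; rewrite -mcoeff_neq0 => wv.
suff /existsP[j /eqP <-] : [exists j, word j == w] by rewrite /fdeg size_tuple.
apply: contraNT wv; rewrite negb_exists => /forallP nw.
rewrite raddf_sum big1 // => j _.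
by rewrite /= mcoeffU (negbTE (nw j)).
Qed.

Lemma homogeneous_rowpoly (q : ncpoly R n) : homogeneous d q ->
  q = rowpoly (\row_j q@_(word j)).
Proof.
move=> hq; apply/malgP => w.
have [wq|wq] := boolP (fdeg w == d).
  suff [j <-] : exists j, word j = w by rewrite mcoeff_rowpoly mxE.
  exists (enum_rank (Tuple wq)); rewrite /word enum_rankK /=.
  exact: fmK.
have out (q' : ncpoly R n) : homogeneous d q' -> q'@_w = 0.
  by move=> h; apply: mcoeff_outdom; apply: contraNN wq => /h ->.
by rewrite !out //; exact: rowpoly_homogeneous.
Qed.

Lemma hsquare_rowpoly (v : 'rV[C]_m) :
  ncstar (rowpoly v) * rowpoly v =
  grampoly (\matrix_(i, j) ((v 0 i)^*%C * v 0 j)).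
Proof.
rewrite ncstar_sum mulr_suml; apply: eq_bigr => i _.
rewrite mulr_sumr; apply: eq_bigr => j _.
by rewrite ncstarU malgM_def fgmulUU mxE.
Qed.

Local Open Scope sesquilinear_scope.

(** Each row gives a square with a rank-one Gram matrix, and [W^t* *m W] is the sum of these
    matrices. *)
Lemma hsquares_sum_rowpoly r (W : 'M[C]_(r, m)) :
  hsquares_sum [seq rowpoly (row k W) | k <- enum 'I_r] =
  grampoly (W^t* *m W).
Proof.
rewrite /hsquares_sum big_map big_enum /=.
under eq_bigr do rewrite hsquare_rowpoly.
rewrite -grampoly_sum; congr grampoly; apply/matrixP => i j.
by rewrite !mxE summxE; apply: eq_bigr => k _; rewrite !mxE.
Qed.

Lemma is_hsos_gram (p : ncpoly R n) : is_hsos d p ->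
  exists r (W : 'M[C]_(r, m)), p = grampoly (W^t* *m W).
Proof.
case=> ws hws ->.
exists (size ws), (\matrix_(k, j) (ws`_k)@_(word j)).
rewrite -hsquares_sum_rowpoly /hsquares_sum big_map big_enum /=.
rewrite (big_nth 0) big_mkord; apply: eq_bigr => k _.
set u := rowpoly _; suff -> : ws`_k = u by [].
rewrite [LHS]homogeneous_rowpoly; last by apply/hws/mem_nth.
by congr rowpoly; apply/rowP => j; rewrite !mxE.
Qed.

(** The words [nu^* nu] are the diagonal ones, [sqword i i]. *)
Lemma squares_coef_sum_gram (A : 'M[C]_m) :
  squares_coef_sum d (grampoly A) = \tr A.
Proof.
rewrite /squares_coef_sum (reindex (@enum_val T predT)) /=; last first.
  exact/onW_bij/enum_val_bij.
by apply: eq_bigr => i _; rewrite -mcoeff_grampoly.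
Qed.

Lemma msupp_grampoly (A : 'M[C]_m) :
  {subset msupp (grampoly A) <=
     codom (fun ij : 'I_m * 'I_m => sqword ij.1 ij.2)}.
Proof.
move=> w; apply: contraTT => /codomP nw; rewrite -mcoeff_eq0.
rewrite raddf_sum big1 // => i _; rewrite raddf_sum big1 // => j _ /=.
by rewrite mcoeffU; case: eqP => // ijw; case: nw; exists (i, j).
Qed.

(** The coefficient norm is the Frobenius norm of [A]. The hypothesis lives in [R[i]], where moduli
    of matrix entries take their values, and is brought down to [R] by [lecR]. *)
Lemma norm2_grampoly_le (A : 'M[C]_m) (e : R) : 0 <= e ->
  \sum_j \sum_i `|A i j| ^+ 2 <= e%:C ^+ 2 -> norm2 (grampoly A) <= e.
Proof.
move=> e0; rewrite (norm2_reindex _ (@msupp_grampoly A)); last first.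
  by move=> [i j] [k l] /= /eqP; rewrite sqword_inj => /andP[/eqP-> /eqP->].
rewrite exchange_big pair_big /= -rmorphXn /= => le.
rewrite -[leRHS](ger0_norm e0) -sqrtr_sqr ler_sqrt ?sqr_ge0 // -lecR.
apply: le_trans le; rewrite rmorph_sum /=; apply: ler_sum => -[i j] _ /=.
by rewrite mcoeff_grampoly rmorphXn.
Qed.
End Words.

Theorem theorem8 (R : realType) (n d : nat) (p : ncpoly R n) (eps : R) :
  is_hsos d p -> 0 < eps ->
  exists q : ncpoly R n,
    norm2 (p - q) <= eps /\
    exists ws : seq (ncpoly R n),
      [/\ forall w, w \in ws -> homogeneous d w,
          (size ws)%:R <= squares_coef_sum d p ^+ 2 / eps%:C ^+ 2
        & q = hsquares_sum ws].
Proof.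
move=> /is_hsos_gram[k [W ->]] eps0.
have epsC : 0 < eps%:C by rewrite ltcR.
have [r [V [rank_le dist_le]]] := gram_low_rank W epsC.
exists (grampoly (V^t* *m V)%sesqui); split.
  by rewrite -grampolyB norm2_grampoly_le // ltW.
exists [seq rowpoly (row i V) | i <- enum 'I_r]; split.
- by move=> w /mapP[i _ ->]; exact: rowpoly_homogeneous.
- rewrite size_map size_enum_ord squares_coef_sum_gram.
  by rewrite ler_pdivlMr ?exprn_gt0.
- by rewrite hsquares_sum_rowpoly.
Qed.
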